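(* Let $\lambda$ be an infinite regular cardinal. If $2^\lambda=\lambda^+$, then there is a regular ultrafilter on $\lambda$ which is not doubly regular.
   Context: A family of sets is a regular family if finite intersections of members of the family are non-empty but all infinite intersections (i.e. intersections of infinitely many members) are empty. A filter is $\mu$-regular if it contains a regular family of size $\mu$. A filter on $\lambda$, or on a set of cardinality $\lambda$, is called regular if it is $\lambda$-regular. A filter $D$ on a regular cardinal $\lambda$ is called doubly regular if there are pairwise disjoint sets $u_i\subseteq\lambda$, $i<\lambda$, each of cardinality $\lambda$, and regular filters $D_i$ on $u_i$, such that for all $A\subseteq\lambda$: if $A\cap u_i\in D_i$ for all but boundedly many $i<\lambda$, then $A\in D$. *)

(* Defs.v *)
From mathcomp Require Import all_boot all_order.
From mathcomp Require Import boolp classical_sets functions cardinality filter.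
From mathcomp Require wochoice.

Set Implicit Arguments.
Unset Strict Implicit.
Unset Printing Implicit Defensive.

Local Open Scope classical_set_scope.
Local Open Scope card_scope.
Local Open Scope order_scope.

(* A cardinal is represented, up to isomorphism, as an initial ordinal: a
   well-ordered type all of whose proper initial segments (its elements, as
   ordinals) have strictly smaller cardinality. *)
Definition initial_ordinal (d : Order.disp_t) (L : orderType d) : Prop :=
  wochoice.well_order (<=%O : rel L) /\
  forall x : L, ~~ ([set: L] #<= [set y : L | y < x]).

Definition cofinal_set (d : Order.disp_t) (L : orderType d) (A : set L) : Prop :=
  forall x : L, exists2 y, A y & x <= y.

Definition regular_cardinal (d : Order.disp_t) (L : orderType d) : Prop :=
  [/\ initial_ordinal L, infinite_set [set: L] &
      forall A : set L, cofinal_set A -> A #= [set: L]].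

Definition card_lt (T U : Type) (A : set T) (B : set U) : Prop :=
  (A #<= B) /\ ~~ (B #<= A).

(* |B| = |A|^+, the least cardinal greater than |A| *)
Definition card_succ (T U : Type) (A : set T) (B : set U) : Prop :=
  card_lt A B /\ forall (V : Type) (C : set V), card_lt A C -> B #<= C.

Definition regular_family (T : Type) (E : set_system T) : Prop :=
  (forall F : set_system T, F `<=` E -> finite_set F ->
     \bigcap_(A in F) A !=set0) /\
  (forall F : set_system T, F `<=` E -> infinite_set F ->
     \bigcap_(A in F) A = set0).

(* mu-regularity, where the cardinal mu is given as |M| *)
Definition mu_regular (T U : Type) (M : set U) (D : set_system T) : Prop :=
  exists E : set_system T, [/\ E `<=` D, regular_family E & E #= M].

Definition regular_filter (T : Type) (D : set_system T) : Prop :=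
  mu_regular [set: T] D.

(* A filter on the subset u i is a filter on the subtype associated with u i,
   so the preimage of A under the inclusion set_val stands for A `&` u i. *)
Definition doubly_regular (d : Order.disp_t) (L : orderType d)
    (D : set_system L) : Prop :=
  exists (u : L -> set L) (Du : forall i : L, set_system (u i)),
    [/\ trivIset [set: L] u,
        forall i, u i #= [set: L],
        forall i, ProperFilter (Du i) /\ regular_filter (Du i) &
        forall A : set L,
          (exists b : L, forall i, b <= i -> Du i (set_val @^-1` A)) -> D A].

(* Main.v *)
(* Enumerate the disjoint families u = (u_i), i < lambda, in order type
   lambda^+ = 2^lambda, and extend a regular family of size lambda by one set B
   at a time, keeping the finite intersection property, so that for each u some
   B in the resulting ultrafilter either misses all u_i from some index on, or
   meets each u_i in at most one point. At each stage B has to meet only lambda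
   sets F, the finite intersections so far. If no tail of u can be avoided, each
   F meets u_i for cofinally many i, hence, lambda being regular, for lambda
   many i; so the F can be given distinct indices i_F and points x_F in F and
   u_(i_F), and B is the set of these points.
   Such a B refutes double regularity via u: a regular filter on u_i contains a
   set omitting any given point of u_i, so the ultrafilter would contain the
   union of the u_i \ B, respectively of a tail of u, which is disjoint from
   B. *)
Require Import Defs.
From mathcomp Require Import all_boot all_order.
From mathcomp Require Import boolp classical_sets functions cardinality filter.
From mathcomp Require wochoice.

Import Order.TTheory.

Set Implicit Arguments.
Unset Strict Implicit.
Unset Printing Implicit Defensive.

Local Open Scope order_scope.
Local Open Scope classical_set_scope.
Local Open Scope card_scope.

(** * Well-founded recursion with choice *)

(** As [Q x] looks at [f] only below [x], a choice function for [Q] can be iterated along [lt]; [v0]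
    stands in for values not yet constructed. *)
Lemma wf_choice (I V : Type) (lt : I -> I -> Prop) (v0 : V)
    (Q : I -> (I -> V) -> V -> Prop) :
  well_founded lt ->
  (forall x f g v, (forall y, lt y x -> f y = g y) -> Q x f v -> Q x g v) ->
  (forall x f, (forall y, lt y x -> Q y f (f y)) -> exists v, Q x f v) ->
  exists f, forall x, Q x f (f x).
Proof.
move=> wf Qloc Qex.
have /choice[G GP] : forall xf : I * (I -> V), exists v,
    (exists w, Q xf.1 xf.2 w) -> Q xf.1 xf.2 v.
  move=> xf; have [[w Qw]|nQ] := pselect (exists w, Q xf.1 xf.2 w).
    by exists w.
  by exists v0.
pose F x (rec : forall y, lt y x -> V) :=
  G (x, fun y => if pselect (lt y x) is left h then rec y h else v0).
pose f := Fix wf (fun=> V) F.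
have fE x : f x = G (x, fun y => if pselect (lt y x) is left _ then f y else v0).
  rewrite {1}/f Fix_eq // => {}x r r' rr'; rewrite /F; congr (G (_, _)).
  by apply/funext => y; case: pselect.
exists f; elim/(well_founded_ind wf) => x IH.
pose g y := if pselect (lt y x) is left _ then f y else v0.
have fg y : lt y x -> f y = g y by move=> yx; rewrite /g; case: pselect.
apply: (Qloc _ g); first by move=> y /fg.
rewrite fE; apply: (GP (x, g)) => /=.
by have [w Qw] := Qex x f IH; exists w; exact: Qloc fg Qw.
Qed.

Lemma wf_min (T : Type) (lt : T -> T -> Prop) (P : T -> Prop) :
  well_founded lt -> (exists x, P x) ->
  exists2 x, P x & forall y, lt y x -> ~ P y.
Proof.
move=> wf [x0 Px0]; apply: contrapT => nmin.
suff : forall x, ~ P x by move/(_ x0).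
elim/(well_founded_ind wf) => x IH Px; apply: nmin; by exists x.
Qed.

(** * Injections, well-orders and comparison of cardinals *)

(** Replaces an injection between subtypes by a function on all of [T], with the default [u0]
    outside [A]. *)
Lemma card_le_exinj (T U : Type) (A : set T) (B : set U) (u0 : U) :
  A #<= B -> exists g : T -> U,
    (forall x y, A x -> A y -> g x = g y -> x = y) /\
    (forall x, A x -> B (g x)).
Proof.
move=> /card_leP[f].
pose g x := if pselect (A x) is left h then set_val (f (SigSub (mem_set h))) else u0.
exists g; split=> [x y Ax Ay|x Ax]; rewrite /g.
  case: pselect => // Ax'; case: pselect => // Ay' /val_inj fxy.
  have := @inj _ _ _ f _ _ (mem_set I) (mem_set I) fxy.
  by move=> [].
by case: pselect => // h; exact: set_valP.
Qed.

Lemma exinj_card_le (T U : Type) (A : set T) (B : set U) (g : T -> U) :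
  (forall x y, A x -> A y -> g x = g y -> x = y) ->
  (forall x, A x -> B (g x)) -> A #<= B.
Proof.
move=> ginj gAB; have : g @` A #= A.
  by apply: inj_card_eq => x y; rewrite !inE => Ax Ay; exact: ginj.
rewrite card_eq_le => /andP[_ /card_le_trans]; apply.
by apply: subset_card_le => _ [x Ax <-]; exact: gAB.
Qed.

(** Well-foundedness excludes cycles, so irreflexivity and transitivity follow. *)
Definition strict_total_wf (T : Type) (lt : T -> T -> Prop) :=
  well_founded lt /\ forall x y, [\/ lt x y, x = y | lt y x].

(** Otherwise totality would give a cycle of length two or three. *)
Lemma strict_total_wf_trans (T : Type) (lt : T -> T -> Prop) x y z :
  strict_total_wf lt -> lt x y -> lt y z -> lt x z.
Proof.
move=> [wf tot] xy yz; case: (tot x z) => // [xz|zx]; exfalso.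
  move: yz; rewrite -xz => {z xz}.
  by elim/(well_founded_ind wf): x y xy => x IH y xy yx; exact: (IH y yx x).
elim/(well_founded_ind wf): x y z xy yz zx => x IH y z xy yz zx.
exact: (IH z zx x y).
Qed.

(** If some elements were inaccessible, there would be a least one; but all its predecessors are
    accessible, hence so is it. *)
Lemma well_order_strict (T : eqType) (R : rel T) : wochoice.well_order R ->
  strict_total_wf (fun x y : T => R x y && (x != y)).
Proof.
move=> Rwo.
have Rchain : wochoice.wo_chain R [pred x : T | true] by exact: wochoice.withinW.
have Rtot x y : R x y \/ R y x.
  by apply/orP; exact: (wochoice.wo_chainW Rchain).
have Ranti x y : R x y -> R y x -> x = y.
  move=> xy yx; apply: (wochoice.wo_chain_antisymmetric Rchain) => //.
  by rewrite xy yx.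
split; last first.
  move=> x y; case: (eqVneq x y) => [->|xy]; first by constructor 2.
  by case: (Rtot x y) => h; [constructor 1|constructor 3]; rewrite h //.
apply: contrapT => /existsNP[x0 nacc].
pose nacc_pred x := `[< ~ Acc (fun x y : T => R x y && (x != y)) x >].
have [|z [[/asboolP nz zmin] _]] := Rwo nacc_pred.
  by exists x0; apply/asboolP.
apply: nz; constructor => y /andP[yz neq]; apply: contrapT => ny.
have /zmin zy : y \in nacc_pred by exact/asboolP.
by move: neq; rewrite (Ranti y z) // eqxx.
Qed.

(** A system of distinct representatives, chosen by recursion: the values used before [x] are too
    few to exhaust [S x]. *)
Lemma sdr (I V : Type) (lt : I -> I -> Prop) (v0 : V) (S : I -> set V) :
  strict_total_wf lt ->
  (forall x, ~~ (S x #<= [set y | lt y x])) ->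
  exists2 f : I -> V, injective f & forall x, S x (f x).
Proof.
move=> lto Sbig.
have [|x f g v fg [Sv nv]|x f _|f fP] :=
  @wf_choice I V lt v0 (fun x f v => S x v /\ forall y, lt y x -> f y <> v).
- by case: lto.
- by split=> // y yx; rewrite -fg //; exact: nv.
- apply: contrapT => nex; move: (Sbig x) => /negP; apply.
  apply: (@card_le_trans _ _ _ (f @` [set y | lt y x])).
    apply: subset_card_le => v Sv; apply: contrapT => nv; apply: nex.
    by exists v; split=> // y yx fyv; apply: nv; exists y.
  exact: card_image_le.
exists f => [x y fxy|x]; last by case: (fP x).
case: (lto.2 x y) => // xy.
  by have := (fP y).2 x xy fxy.
by have := (fP x).2 y xy (esym fxy).
Qed.

Lemma well_orderable (T : Type) : exists lt : T -> T -> Prop, strict_total_wf lt.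
Proof.
have [R Rwo] := wochoice.well_ordering_principle {classic T}.
by eexists; exact: (well_order_strict Rwo).
Qed.

(** If [U] does not embed into [T], it embeds into no initial segment of a well-order of [T], so
    distinct values in [U] can be chosen along that order. *)
Lemma card_leT_total (T U : Type) : [set: T] #<= [set: U] \/ [set: U] #<= [set: T].
Proof.
have [|nUT] := boolP ([set: U] #<= [set: T]); [by right|left].
have [u0] : exists u : U, True.
  apply: contrapT => nU; move: nUT => /negP; apply.
  suff -> : [set: U] = set0 by exact: card_ge0.
  by apply/seteqP; split=> // u _; apply: nU; exists u.
move=> _; have [lt lto] := well_orderable T.
have [x|f finj _] := @sdr T U lt u0 (fun=> [set: U]) lto.
  by apply: contra nUT => /card_le_trans; apply; exact: card_leT.
by apply: (exinj_card_le (g := f)) => // x y _ _; exact: finj.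
Qed.

Lemma card_le_total (T U : Type) (A : set T) (B : set U) : A #<= B \/ B #<= A.
Proof.
have [h|h] := card_leT_total A B; [left|right].
  by rewrite -(card_le_eql (card_setT A)) -(card_le_eqr (card_setT B)).
by rewrite -(card_le_eql (card_setT B)) -(card_le_eqr (card_setT A)).
Qed.

(** If some initial segment has full size, the order on the least such segment is pulled back along
    an injection of [T] into it. *)
Lemma initial_well_order (T : Type) : exists2 lt : T -> T -> Prop,
  strict_total_wf lt & forall x, ~~ ([set: T] #<= [set y | lt y x]).
Proof.
have [lt lto] := well_orderable T.
pose P x := [set: T] #<= [set y | lt y x].
have [exP|small] := pselect (exists x, P x); last first.
  by exists lt => // x; apply/negP => Tx; apply: small; exists x.
have [x Tx xmin] := wf_min lto.1 exP.
have [g [ginj glt]] := card_le_exinj x Tx.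
exists (fun a b => lt (g a) (g b)).
  split=> [a|a b].
    move: {-1}(g a) (erefl (g a)) => c; elim/(well_founded_ind lto.1): c a => c IH a gac.
    by constructor=> b ba; apply: (IH (g b)); rewrite // -gac.
  case: (lto.2 (g a) (g b)) => [h|h|h]; [exact: Or31| |exact: Or33].
  exact: Or32 (ginj a b I I h).
move=> a; apply/negP => Ta; apply: (xmin (g a)); first exact: glt.
apply: card_le_trans Ta _; apply: (exinj_card_le (g := g)) => // b c _ _; exact: ginj.
Qed.

(** * Finite sequences over an infinite set *)

(* Zorn's lemma on the graphs of injections [seq Y -> Y], [Y] a subset of [T].
   When [Z] embeds into [Y] and is disjoint from it, [Y `|` Z] embeds into
   [seq Y], hence [seq (Y `|` Z)] into [seq (seq Y)] and into [Y]. If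
   [~` Y] embeds into [Y] this is the result with [Z := ~` Y]; otherwise [~` Y]
   contains a copy [Z] of [Y], which allows the injection to be extended. *)
Lemma infinite_seq_inj (T : choiceType) : infinite_set [set: T] ->
  exists f : seq T -> T, injective f.
Proof.
move=> /infiniteP natT.
have [t0] : exists t : T, True.
  apply: contrapT => nT; have /card_leP[f] := natT.
  by apply: nT; exists (set_val (f (SigSub (mem_set (I : [set: nat] 0%N))))).
move=> _; have [j [j_inj _]] := card_le_exinj t0 natT.
have jinj : injective j by move=> m n; exact: j_inj.
pose dom (G : set (seq T * T)) : set T := [set x | exists y, G ([:: x], y)].
pose over (Y : set T) (s : seq T) := forall x, x \in s -> Y x.
(* The subset [Y] is read off the graph as [dom G], through one-element lists. Totality is asked of
   nonempty graphs only, so that the union of the empty chain qualifies. *)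
pose P (G : set (seq T * T)) :=
  [/\ forall s y y', G (s, y) -> G (s, y') -> y = y',
      forall s s' y, G (s, y) -> G (s', y) -> s = s',
      forall s y, G (s, y) -> over (dom G) s /\ dom G y &
      forall s, G !=set0 -> over (dom G) s -> exists y, G (s, y)].
have [F FP Ftot|G [[Gfun Ginj Gdom Gtot] Gmax]] := @Zorn_bigcup _ P.
  have common p q : (\bigcup_(X in F) X) p -> (\bigcup_(X in F) X) q ->
      exists X, [/\ F X, X p & X q].
    move=> [X FX Xp] [Y FY Yq].
    by have [XY|YX] := Ftot _ _ FX FY; [exists Y|exists X]; split=> //;
      [exact: XY|exact: YX].
  have domS X : F X -> dom X `<=` dom (\bigcup_(X in F) X).
    by move=> FX x [y Xy]; exists y, X.
  split.
  - move=> s y y' Gs Gs'; have [X [/FP[Xf _ _ _] Xs Xs']] := common _ _ Gs Gs'.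
    exact: Xf Xs Xs'.
  - move=> s s' y Gs Gs'; have [X [/FP[_ Xi _ _] Xs Xs']] := common _ _ Gs Gs'.
    exact: Xi Xs Xs'.
  - move=> s y [X FX Xs]; have [_ _ Xd _] := FP _ FX.
    have [sX yX] := Xd _ _ Xs; split; last exact: (domS X).
    by move=> x xs; apply: (domS X) => //; exact: sX.
  move=> s [p0 [X0 FX0 X0p]].
  have : over (dom (\bigcup_(X in F) X)) s ->
      exists X, [/\ F X, X !=set0 & over (dom X) s].
    elim: s => [_|x s IH sG]; first by exists X0; split=> //; exists p0.
    have [|X [FX Xn Xs]] := IH; first by move=> y ys; apply: sG; rewrite inE ys orbT.
    have [y [Y FY Yx]] := sG x (mem_head _ _).
    have [XY|YX] := Ftot _ _ FX FY; [exists Y|exists X]; split=> //.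
    - by exists ([:: x], y).
    - move=> z; rewrite inE => /predU1P[->|zs]; first by exists y.
      by have [w Xw] := Xs z zs; exists w; exact: XY.
    - move=> z; rewrite inE => /predU1P[->|zs]; last exact: Xs.
      by exists y; exact: YX.
  move=> h /h[X [FX Xn Xs]]; have [_ _ _ Xt] := FP _ FX.
  by have [y Xy] := Xt s Xn Xs; exists y, X.
(* The empty graph is not maximal: the copy [range j] of the natural numbers carries an injection,
   as lists of numbers are countable. *)
have Gn0 : G !=set0.
  apply: contrapT => Gempty.
  pose G0 : set (seq T * T) := range (fun s : seq nat => (map j s, j (pickle s))).
  have domG0 x : dom G0 x <-> range j x.
    split=> [[y [[|k s] _ [] // kx]]|[k _ <-]]; first by exists k.
    by exists (j (pickle [:: k])), [:: k].
  apply: (Gmax G0).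
    split; last first.
      move=> sub; have /sub Gx : G0 (map j [::], j (pickle ([::] : seq nat))).
        by exists [::].
      by apply: Gempty; exists (map j [::], j (pickle ([::] : seq nat))).
    by move=> p Gp; case: Gempty; exists p.
  split.
  - by move=> s y y' [r _ [<- <-]] [r' _ [/(inj_map jinj) -> <-]].
  - move=> s s' y [r _ [<- <-]] [r' _ [<-]].
    by move=> /jinj/(pcan_inj pickleK)->.
  - move=> s y [r _ [<- <-]]; split; last by apply/domG0; exists (pickle r).
    by move=> x /mapP[k _ ->]; apply/domG0; exists k.
  - move=> s _ sG; have : exists r, s = map j r.
      elim: s sG => [|x s IH] sG; first by exists [::].
      have [|r ->] := IH; first by move=> y ys; apply: sG; rewrite inE ys orbT.
      have /domG0[k _ <-] := sG x (mem_head _ _).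
      by exists (k :: r).
    by move=> [r ->]; exists (j (pickle r)), r.
pose Y := dom G.
have /choice[F FG] : forall s, exists y, over Y s -> G (s, y).
  move=> s; have [sY|nsY] := pselect (over Y s); last by exists t0.
  by have [y Gy] := Gtot s Gn0 sY; exists y.
have FY s : over Y s -> Y (F s) by move=> /FG/Gdom[].
have Finj s s' : over Y s -> over Y s' -> F s = F s' -> s = s'.
  by move=> /FG Gs /FG Gs' ss'; apply: Ginj Gs _; rewrite ss'.
have over1 x : Y x -> over Y [:: x] by move=> Yx y; rewrite inE => /eqP->.
have over2 x : Y x -> over Y [:: x; x].
  by move=> Yx y; rewrite !inE => /orP[] /eqP->.
have coding (Z : set T) (h : T -> T) :
    (forall x y, Z x -> Z y -> h x = h y -> x = y) ->
    (forall x, Z x -> Y (h x)) ->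
  exists e : seq T -> T, (forall s, over (Y `|` Z) s -> Y (e s)) /\
    forall s s', over (Y `|` Z) s -> over (Y `|` Z) s' -> e s = e s' -> s = s'.
  move=> hinj hY.
  pose k x := if `[< Y x >] then [:: x] else [:: h x; h x].
  have kY x : (Y `|` Z) x -> over Y (k x).
    by rewrite /k; case: asboolP => [Yx _|nY [//|/hY]]; [exact: over1|exact: over2].
  have kinj x y : (Y `|` Z) x -> (Y `|` Z) y -> k x = k y -> x = y.
    rewrite /k; case: asboolP => [Yx _|nYx [//|Zx]];
      case: asboolP => [Yy _|nYy [//|Zy]] // [] //.
    by move=> hxy _; exact: hinj.
  have kFY s : over (Y `|` Z) s -> over Y (map (F \o k) s).
    by move=> sYZ _ /mapP[x xs ->]; apply/FY/kY/sYZ.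
  exists (F \o map (F \o k)); split=> [s sYZ|s s' sYZ s'YZ].
    exact/FY/kFY.
  move=> /(Finj _ _ (kFY _ sYZ) (kFY _ s'YZ)).
  elim: s s' sYZ s'YZ => [|x s IH] [|y s'] //= sYZ s'YZ [].
  have xYZ := sYZ x (mem_head _ _); have yYZ := s'YZ y (mem_head _ _).
  move=> /(Finj _ _ (kY _ xYZ) (kY _ yYZ))/(kinj _ _ xYZ yYZ)->.
  move=> /IH -> // z zs; [apply: sYZ|apply: s'YZ]; by rewrite inE zs orbT.
have [/(card_le_exinj t0)[h [hinj hY]]|] := card_le_total (~` Y) Y.
  have [e [_ einj]] := coding _ h hinj hY.
  by exists e => s s'; apply: einj => x _; exact: (EM (Y x)).
move=> /(card_le_exinj t0)[h [hinj hY]].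
pose Z := h @` Y.
have YZ x : Y x -> Z x -> False by move=> Yx [y /hY nY yx]; apply: nY; rewrite yx.
have /choice[g gh] : forall z, exists y, Z z -> Y y /\ h y = z.
  move=> z; have [[y Yy yz]|nZ] := pselect (Z z); first by exists y.
  by exists t0.
have [||e [eY einj]] := coding Z g.
- by move=> x y /gh[_ {2}<-] /gh[_ {2}<-] ->.
- by move=> x /gh[].
(* The new lists are sent by [e] into [Y] and then by [h] into [Z], away from the old values. *)
pose H := G `|` [set p | [/\ over (Y `|` Z) p.1, ~ over Y p.1 & p.2 = h (e p.1)]].
have domH x : dom H x <-> (Y `|` Z) x.
  split=> [[y [Gx|[/(_ x (mem_head _ _)) //]]]|[Yx|Zx]].
  - by left; exists y.
  - by exists (F [:: x]); left; apply/FG/over1.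
  exists (h (e [:: x])); right; split=> //= [y|].
    by rewrite inE => /eqP->; right.
  by move=> /(_ x (mem_head _ _)) Yx; exact: (YZ x).
have hYY y : Y (h y) -> Y y -> False by move=> + Yy; exact: hY.
apply: False_ind; apply: (Gmax H).
  split; first by move=> p; left.
  have [[s0 y0] /Gdom[_ Yy0]] := Gn0.
  move=> HG; have /HG/Gdom[/(_ (h y0) (mem_head _ _))] : H ([:: h y0], h (e [:: h y0])).
    right; split=> //= [y|sY].
      by rewrite inE => /eqP->; right; exists y0.
    exact: (hYY y0 (sY _ (mem_head _ _)) Yy0).
  by move=> /hYY [].
split.
- move=> s y y' [Gs|[/= sYZ nsY ->]] [Gs'|[/= sYZ' nsY' ->]] //.
  + exact: Gfun Gs Gs'.
  + by case: nsY'; case: (Gdom _ _ Gs).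
  + by case: nsY; case: (Gdom _ _ Gs').
- move=> s s' y [Gs|[/= sYZ nsY ->]] [Gs'|[/= sYZ' nsY']] //.
  + exact: Ginj Gs Gs'.
  + move=> yE; have [_] := Gdom _ _ Gs; rewrite -/Y yE => /hYY []; exact: eY.
  + have [_ /hYY []] := Gdom _ _ Gs'; exact: eY.
  + by move=> /(hinj _ _ (eY _ sYZ) (eY _ sYZ'))/einj; apply.
- move=> s y [/[dup]/Gdom[sY Yy] Gs|[/= sYZ nsY ->]].
    by split=> [x /sY Yx|]; apply/domH; left.
  split=> [x /sYZ xYZ|]; first exact/domH.
  by apply/domH; right; exists (e s) => //; exact: eY.
move=> s _ sH; have sYZ : over (Y `|` Z) s by move=> x /sH/domH.
have [sY|nsY] := pselect (over Y s); first by exists (F s); left; exact: FG.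
by exists (h (e s)); right.
Qed.

(** Lists of lengths one and two keep the images of [A] and of the rest of [B] apart. *)
Lemma card_setU_leT (T : Type) (L : choiceType) (A B : set T) :
  infinite_set [set: L] -> A #<= [set: L] -> B #<= [set: L] ->
  A `|` B #<= [set: L].
Proof.
move=> /[dup] /infinite_setN0[x0 _] /infinite_seq_inj[f finj].
move=> /(card_le_exinj x0)[g [ginj _]] /(card_le_exinj x0)[h [hinj _]].
apply: (exinj_card_le (g := fun x =>
  if `[< A x >] then f [:: g x] else f [:: h x; h x])) => // x y.
case: asboolP => [Ax _|nAx [//|Bx]];
  case: asboolP => [Ay _|nAy [//|By]] /finj // [].
- exact: ginj.
- by move=> hxy _; exact: hinj.
Qed.

(** * Finite intersection property and ultrafilters *)

Definition fip (T : Type) (G : set_system T) :=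
  forall s : seq (set T), [set` s] `<=` G -> \bigcap_(A in [set` s]) A !=set0.

(** The supersets of finite intersections from [G] form a proper filter. *)
Lemma fip_ultra (T : Type) (G : set_system T) : fip G ->
  exists D : set_system T, UltraFilter D /\ G `<=` D.
Proof.
move=> Gfip.
pose F : set_system T := [set A | exists2 s : seq (set T),
  [set` s] `<=` G & \bigcap_(B in [set` s]) B `<=` A].
have FP : ProperFilter F.
  split.
    by move=> [s sG s0]; have [x /s0] := Gfip s sG.
  split.
  - by exists [::].
  - move=> A B [s sG sA] [t tG tB]; exists (s ++ t) => [C /=|x xst].
      by rewrite mem_cat => /orP[/sG|/tG].
    split; [apply: sA|apply: tB] => C /= Cs; apply: xst => /=;
      by rewrite mem_cat Cs ?orbT.
  - by move=> A B AB [s sG sA]; exists s => //; exact: subset_trans sA AB.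
have [D [Dultra FD]] := ultraFilterLemma FP.
exists D; split=> // A GA; apply: FD; exists [:: A] => [B|x]; last first.
  by apply; rewrite /= inE.
by rewrite /= inE => /eqP->.
Qed.

(** A list involves only finitely many [f b], so it already lies in the family of the largest stage
    used. This serves both at each stage of the recursion and for its result. *)
Lemma fip_chain (I T : Type) (lt : I -> I -> Prop) (E : set_system T)
    (f : I -> set T) (D : set I) :
  strict_total_wf lt -> fip E ->
  (forall a, D a -> fip (E `|` f @` [set b | lt b a] `|` [set f a])) ->
  fip (E `|` f @` D).
Proof.
move=> lto Efip ffip s sED.
suff [sE|[a Da sa]] : [set` s] `<=` E \/ exists2 a, D a &
    [set` s] `<=` E `|` f @` [set b | lt b a] `|` [set f a].
- exact: Efip.
- exact: ffip Da _ sa.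
elim: s sED => [|A s IH] sED; first by left.
have sub B (G : set_system T) : G A -> [set` s] `<=` G -> B \in A :: s -> G B.
  by move=> GA sG; rewrite inE => /predU1P[->//|/sG].
have [|sE|[a Da sa]] := IH; first by move=> B /= Bs; apply: sED; rewrite /= inE Bs orbT.
  have [EA|[b Db bA]] := sED A (mem_head _ _).
    by left => B; exact: sub.
  right; exists b => // B; apply: sub; first by right.
  by move=> C /sE EC; left; left.
right; have [EA|[b Db bA]] := sED A (mem_head _ _).
  by exists a => // B; apply: sub => //; left; left.
have [ba|ba|ab] := lto.2 b a.
- by exists a => // B; apply: sub => //; left; right; exists b.
- by exists a => // B; apply: sub => //; right; rewrite -ba.
exists b => // B; apply: sub; first by right.
move=> C /sa[[EC|[c ca <-]]|->]; first by left; left.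
  by left; right; exists c => //; exact: strict_total_wf_trans ca ab.
by left; right; exists a.
Qed.

(** * Adjoining one thin set *)

Definition thin (d : Order.disp_t) (L : orderType d) (u : L -> set L)
    (B : set L) :=
  (exists b, B `&` \bigcup_(i in [set i | b <= i]) u i = set0) \/
  forall i x y, (B `&` u i) x -> (B `&` u i) y -> x = y.

Lemma regular_cardinal_lt (d : Order.disp_t) (L : orderType d) :
  regular_cardinal L -> strict_total_wf (fun x y : L => x < y).
Proof.
move=> [[Lwo _] _ _].
suff -> : (fun x y : L => x < y : Prop) = (fun x y : L => (x <= y) && (x != y) : Prop).
  exact: well_order_strict.
by apply/funext => x; apply/funext => y; rewrite lt_neqAle andbC.
Qed.

Lemma fip_thin (d : Order.disp_t) (L : orderType d) (G : set_system L)
    (u : L -> set L) :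
  regular_cardinal L -> G #<= [set: L] -> fip G -> trivIset [set: L] u ->
  exists2 B, thin u B & fip (G `|` [set B]).
Proof.
move=> Lreg GL Gfip utriv.
have [[Lwo Lini] Linf Lcof] := Lreg.
have lto := regular_cardinal_lt Lreg.
have [x0 _] := infinite_setN0 Linf.
have fipU B : (forall s : seq (set L), [set` s] `<=` G ->
    \bigcap_(A in [set` s]) A `&` B !=set0) -> fip (G `|` [set B]).
  move=> GB s sGB; have [|x [xG Bx]] := GB [seq A <- s | `[< G A >]].
    by move=> A /=; rewrite mem_filter => /andP[/asboolP].
  exists x => A /= As; have [GA|->//] := sGB A As.
  by apply: xG; rewrite /= mem_filter As andbT; apply/asboolP.
have [[b bG]|Gcof] := pselect (exists b, forall s : seq (set L), [set` s] `<=` G ->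
    \bigcap_(A in [set` s]) A `&` ~` (\bigcup_(i in [set i | b <= i]) u i) !=set0).
  exists (~` (\bigcup_(i in [set i | b <= i]) u i)); last exact: fipU.
  by left; exists b; rewrite setICl.
(* As the tail from [b] cannot be avoided, some finite intersection lies inside it; a point shared
   with that of [s] gives an index at or above [b]. *)
have meet (s : seq (set L)) : [set` s] `<=` G ->
    [set i | \bigcap_(A in [set` s]) A `&` u i !=set0] #= [set: L].
  move=> sG; apply: Lcof => b.
  have [t tG tb] : exists2 t : seq (set L), [set` t] `<=` G &
      \bigcap_(A in [set` t]) A `<=` \bigcup_(i in [set i | b <= i]) u i.
    apply: contrapT => nt; apply: Gcof; exists b => t tG.
    apply: contrapT => t0; apply: nt; exists t => // x tx.
    by apply: contrapT => xu; apply: t0; exists x.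
  have [|x xst] := Gfip (s ++ t).
    by move=> A /=; rewrite mem_cat => /orP[/sG|/tG].
  have [|i bi uix] := tb x.
    by move=> A /= At; apply: xst; rewrite /= mem_cat At orbT.
  exists i => //; exists x; split=> // A /= As; apply: xst.
  by rewrite /= mem_cat As.
have [f finj] := infinite_seq_inj Linf.
have [g [ginj _]] := card_le_exinj x0 GL.
(* [c] decodes lists in [G] from their codes in [L], so the finite intersections are indexed by [L];
   non-codes yield the empty list, whose intersection is everything. *)
have /choice[c cP] : forall k : L, exists s : seq (set L), [set` s] `<=` G /\
    forall t : seq (set L), [set` t] `<=` G -> f (map g t) = k -> s = t.
  move=> k; have [[s sG sk]|nk] := pselect
    (exists2 s : seq (set L), [set` s] `<=` G & f (map g s) = k).
    exists s; split=> // t tG; rewrite -sk => /finj/esym.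
    elim: s t {sk} sG tG => [|A s IH] [|B t] // sG tG /= [].
    have GA := sG A (mem_head _ _); have GB := tG B (mem_head _ _).
    move=> gAB gst; rewrite (ginj A B GA GB gAB) (IH t) // => C /= Cs;
      [apply: sG|apply: tG]; by rewrite /= inE Cs orbT.
  exists [::]; split=> // t tG tk; exfalso; apply: nk; by exists t.
(* Each set of admissible indices has size lambda, more than any proper initial segment of [L], so
   the indices [i k] can be chosen distinct. *)
have [k|i iinj iP] := @sdr L L (fun x y => x < y) x0
  (fun k => [set i | \bigcap_(A in [set` c k]) A `&` u i !=set0]) lto.
  have [ck _] := cP k; rewrite (card_le_eql (meet _ ck)); exact: Lini.
have /choice[t tP] := iP.
exists (range t).
  (* By disjointness of [u], a chosen point determines its index: [i k] and [i l] both equal [j]. *)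
  right => j x y [[k _ <-] uk] [[l _ <-] ul].
  have -> // : k = l; apply: iinj.
  have ukj : i k = j.
    by apply: (utriv _ _ I I); exists (t k); split=> //; case: (tP k).
  rewrite ukj; apply: esym.
  by apply: (utriv _ _ I I); exists (t l); split=> //; case: (tP l).
apply: fipU => s sG; pose k := f (map g s).
have cks : c k = s by exact: (cP k).2.
by exists (t k); split; [have [] := tP k; rewrite cks|exists k].
Qed.

(** * A regular family of size lambda *)

(** Points are read as codes of lists, and [E_ a] collects the lists containing [a]: finitely many
    elements lie in a common list, infinitely many do not. *)
Lemma regular_family_exists (L : choiceType) : infinite_set [set: L] ->
  exists E : set_system L, [/\ regular_family E, fip E & E #= [set: L]].
Proof.
move=> /[dup] Linf /infinite_seq_inj[f finj].
pose E_ a := [set x | exists2 s, f s = x & a \in s].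
have E_inj a b : E_ a = E_ b -> a = b.
  move=> ab; have : E_ b (f [:: a]) by rewrite -ab; exists [:: a]; rewrite ?inE.
  by move=> [s /finj ->]; rewrite inE => /eqP.
have Efip : fip (range E_).
  move=> s sE; have [t tP] : exists t : seq L,
      forall A, A \in s -> exists2 a, E_ a = A & a \in t.
    elim: s sE => [|A s IH] sE; first by exists [::].
    have [|t tP] := IH; first by move=> B /= Bs; apply: (sE B); rewrite /= inE Bs orbT.
    have [a _ aA] := sE A (mem_head _ _).
    exists (a :: t) => B; rewrite inE => /predU1P[->|/tP[b bB bt]].
      by exists a => //; exact: mem_head.
    by exists b => //; rewrite inE bt orbT.
  by exists (f t) => A /= /tP[a <- ta]; exists t.
exists (range E_); split=> //; last first.
  by apply: inj_card_eq => a b _ _; exact: E_inj.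
split=> F FE Ffin.
  have [s Fs] := (finite_seqP F).1 Ffin.
  by rewrite Fs; apply: Efip; rewrite -Fs.
apply/seteqP; split=> // x xF; exfalso; apply: Ffin.
have [[s sx]|ns] := pselect (exists s, f s = x).
  apply: (@sub_finite_set _ _ (E_ @` [set` s])); last first.
    by apply: finite_image; exact: finite_seq.
  move=> A FA; have [a _ aA] := FE A FA; exists a => //=.
  have := xF A FA; rewrite -aA => -[t tx at_].
  by have -> : s = t by apply: finj; rewrite sx tx.
(* A point coding no list lies in no [E_ a], so a family whose members all contain it is empty. *)
have -> : F = set0; last exact: finite_set0.
apply/seteqP; split=> // A FA; have [a _ aA] := FE A FA.
have := xF A FA; rewrite -aA => -[t tx _].
by apply: ns; exists t.
Qed.

(** * Construction of the ultrafilter *)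

Theorem theorem7 (d : Order.disp_t) (L : orderType d)
    (Lreg : regular_cardinal L)
    (GCH : card_succ [set: L]%classic [set: set L]%classic) :
  exists D : set_system L,
    [/\ UltraFilter D, regular_filter D & ~ doubly_regular D].
Proof.
have [_ Linf _] := Lreg.
have [E [Ereg Efip EL]] := regular_family_exists Linf.
have [lt lto ltsmall] := initial_well_order (set L).
(* A segment larger than lambda would by [GCH] have size at least 2^lambda, contradicting
   [ltsmall]. *)
have segL a : [set b | lt b a] #<= [set: L].
  have [|Lseg] := card_le_total [set b | lt b a] [set: L]; first by [].
  apply: contrapT => nsegL; move: (ltsmall a) => /negP; apply.
  by apply: GCH.2; split=> //; apply/negP.
have [h hinj] := infinite_seq_inj Linf.
(* A set codes a family of sets, so the recursion can run along [set L]. *)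
pose u_ (X : set L) (i : L) : set L := [set x | X (h [:: i; x])].
have u_surj u : exists X, u_ X = u.
  exists [set y | exists i x, y = h [:: i; x] /\ u i x].
  apply/funext => i; apply/seteqP; split=> [x [j [y [/hinj[-> ->]]]]|x uix] //.
  by exists i, x.
pose seg (f : set L -> set L) a := E `|` f @` [set b | lt b a].
(* Stage [a] keeps the finite intersection property and treats the family coded by [a], provided
   that family is disjoint. *)
have [|a f g B fg|a f IH|f fP] := @wf_choice _ _ lt set0 (fun a f B =>
  fip (seg f a `|` [set B]) /\ (trivIset [set: L] (u_ a) -> thin (u_ a) B)).
- exact: lto.1.
- suff -> : seg f a = seg g a by [].
  congr (_ `|` _); apply/seteqP; split=> _ [b ba <-]; exists b => //.
    by rewrite fg.
  by rewrite -fg.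
- have segfip : fip (seg f a) by apply: (fip_chain lto Efip) => b /IH[].
  have segcard : seg f a #<= [set: L].
    apply: card_setU_leT => //; first by rewrite (card_le_eql EL).
    exact: card_le_trans (card_image_le _ _) (segL a).
  have [utriv|nutriv] := pselect (trivIset [set: L] (u_ a)).
    by have [B Bthin Bfip] := fip_thin Lreg segcard segfip utriv; exists B.
  (* When [a] codes no disjoint family, adding the whole set preserves the finite intersection
     property. *)
  exists setT; split=> // s sG.
  have [|x xs] := segfip [seq A <- s | `[< seg f a A >]].
    by move=> A /=; rewrite mem_filter => /andP[/asboolP].
  exists x => A /= As; have [GA|->//] := sG A As.
  by apply: xs; rewrite /= mem_filter As andbT; apply/asboolP.
have /fip_ultra[D [Dultra EfD]] : fip (E `|` range f).
  by apply: (fip_chain lto Efip) => a _; exact: (fP a).1.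
exists D; split=> //.
  by exists E; split=> // A EA; apply: EfD; left.
move=> [u [Du [utriv uL Dureg DuD]]].
have [X Xu] := u_surj u.
have Ddisj A : D A -> D (f X) -> A `&` f X = set0 -> False.
  by move=> DA DB AB; apply: (filter_not_empty D); rewrite -AB; exact: filterI.
have DfX : D (f X) by apply: EfD; right; exists X.
have [_] := fP X; rewrite Xu => /(_ utriv)[[b bX]|uX].
  (* [f X] misses this tail, whose trace on each [u i] with [b <= i] is all of [u i]. *)
  apply: (Ddisj (\bigcup_(i in [set i | b <= i]) u i)) => //; last by rewrite setIC.
  apply: DuD; exists b => i bi; have [? _] := Dureg i.
  suff -> : set_val @^-1` (\bigcup_(i in [set i | b <= i]) u i) = [set: u i].
    exact: filterT.
  by apply/seteqP; split=> // x _; exists i => //; exact: set_valP.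
(* Here [f X] has at most one point in each [u i], and deleting it leaves a set in [Du i]. *)
apply: (Ddisj (\bigcup_i (u i `\` f X))) => //; last first.
  by apply/seteqP; split=> // x [[i _ []]].
apply: DuD; have [x0 _] := infinite_setN0 Linf; exists x0 => i _.
have [Dupf [Ei [EiD [_ Eiinf] EiM]]] := Dureg i.
have [[x fx]|nx] := pselect (exists x : u i, f X (set_val x)); last first.
  apply: (@filterS _ _ _ setT) => [y _|]; last exact: filterT.
  exists i => //; split; first exact: set_valP.
  by move=> fy; apply: nx; exists y.
(* [Ei] has the size of [u i], hence of [L]; being infinite, it has empty intersection, so some
   member omits [x]. *)
have Eiinfinite : infinite_set Ei.
  move=> Eifin; apply: Linf; move: Eifin.
  rewrite (eq_finite_set EiM) (eq_finite_set (card_setT _)).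
  by rewrite (eq_finite_set (uL i)).
have [A EiA nAx] : exists2 A, Ei A & ~ A x.
  apply: contrapT => nA; have : (\bigcap_(A in Ei) A) x.
    by move=> A EiA; apply: contrapT => nAx; apply: nA; exists A.
  by rewrite Eiinf.
apply: (filterS _ (EiD _ EiA)) => y Ay.
exists i => //; split; first exact: set_valP.
move=> fy; apply: nAx; suff -> : x = y by [].
by apply: val_inj; apply: (uX i); split=> //; exact: set_valP.
Qed.
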